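(* Let $\mathcal{H}=\mathcal{H}_0\oplus\mathcal{H}_1$ be an orthogonal decomposition of a Hilbert space and let $T\in\mathcal{B}(\mathcal{H})$ have the block matrix form $$T=\begin{pmatrix}C_0&C\\0&C_1\end{pmatrix},$$ where $C_i\in\mathcal{B}(\mathcal{H}_i)$ are contractions ($i=0,1$) and $C\in\mathcal{B}(\mathcal{H}_1,\mathcal{H}_0)$ satisfies $CC_1=C_0C$. Then $T$ has a $3$-isometric lifting $S$ on some Hilbert space $\mathcal{K}\supset\mathcal{H}$.
   Context: If $\mathcal{H}$ is a closed subspace of a Hilbert space $\mathcal{K}$ with orthogonal projection $P_{\mathcal{H}}$, an operator $S\in\mathcal{B}(\mathcal{K})$ is a lifting of $T\in\mathcal{B}(\mathcal{H})$ if $TP_{\mathcal{H}}=P_{\mathcal{H}}S$. $S$ is $3$-isometric if $\sum_{j=0}^3 (-1)^j\binom{3}{j} S^{*j}S^j=0$. *)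

(* Defs.v *)
From mathcomp Require Import all_boot all_algebra.
From mathcomp Require Import complex reals.
Set Implicit Arguments. Unset Strict Implicit. Unset Printing Implicit Defensive.
Import GRing.Theory Num.Theory.
Local Open Scope ring_scope.

Section PreHilbert.
Variable R : realType.
Variable V : lmodType R[i].
Variable ip : V -> V -> R[i].

Definition ipnorm (x : V) : R := Num.sqrt (complex.Re (ip x x)).

Definition ip_cauchy (u : nat -> V) : Prop :=
  forall e : R, 0 < e -> exists N : nat, forall m n : nat,
    (N <= m)%N -> (N <= n)%N -> ipnorm (u m - u n) < e.

Definition ip_converges (u : nat -> V) (l : V) : Prop :=
  forall e : R, 0 < e -> exists N : nat, forall n : nat,
    (N <= n)%N -> ipnorm (u n - l) < e.
End PreHilbert.

Record hilbert (R : realType) := Hilbert {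
  hvec :> lmodType R[i];
  hinner : hvec -> hvec -> R[i];
  hinnerDl : forall (a : R[i]) (x y z : hvec),
      hinner (a *: x + y) z = a * hinner x z + hinner y z;
  hinner_conj : forall x y : hvec, hinner y x = conjc (hinner x y);
  hinner_ge0 : forall x : hvec, 0 <= hinner x x;
  hinner_eq0 : forall x : hvec, hinner x x = 0 -> x = 0;
  hcomplete : forall u : nat -> hvec, ip_cauchy hinner u ->
      exists l : hvec, ip_converges hinner u l
}.

Section Operators.
Variable R : realType.

Definition hnorm (H : hilbert R) (x : H) : R := ipnorm (@hinner R H) x.

Definition is_linear (H K : hilbert R) (A : H -> K) : Prop :=
  forall (a : R[i]) (x y : H), A (a *: x + y) = a *: A x + A y.

Definition bounded_op (H K : hilbert R) (A : H -> K) : Prop :=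
  is_linear A /\ exists M : R, forall x : H, hnorm (A x) <= M * hnorm x.

Definition contraction (H K : hilbert R) (A : H -> K) : Prop :=
  bounded_op A /\ forall x : H, hnorm (A x) <= hnorm x.

Definition is_adjoint (H K : hilbert R) (A : H -> K) (Astar : K -> H) : Prop :=
  forall (x : H) (y : K), hinner (A x) y = hinner x (Astar y).

Definition isometric_embedding (H K : hilbert R) (J : H -> K) : Prop :=
  is_linear J /\ forall x y : H, hinner (J x) (J y) = hinner x y.

Definition three_isometric (K : hilbert R) (S : K -> K) : Prop :=
  bounded_op S /\ exists Sstar : K -> K, is_adjoint S Sstar /\
    forall x : K,
      \sum_(j < 4) (((-1) ^+ j * ('C(3, j))%:R) : R[i]) *: iter j Sstar (iter j S x) = 0.

(* S in B(K) is a lifting of T in B(H), where H is identified with the closed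
   subspace J(H) of K via the isometric embedding J with adjoint Jstar; the
   orthogonal projection of K onto J(H) is P_H = J o Jstar, and the lifting
   condition T P_H = P_H S reads J (T (Jstar k)) = J (Jstar (S k)). *)
Definition is_lifting (H K : hilbert R) (J : H -> K) (Jstar : K -> H)
    (T : H -> H) (S : K -> K) : Prop :=
  forall k : K, J (T (Jstar k)) = J (Jstar (S k)).
End Operators.

(* Main.v *)
(* By Sz.-Nagy's dilation theorem C1 lifts to an isometry V on K1, and, after
   scaling C, commutant lifting provides an isometric lifting U of C0 on a space
   F together with an intertwiner X : K1 -> F, U X = X V, which lifts C.  The
   operator S = [[U, X], [0, V]] on F (+) K1 then lifts T, and since
   S^n (f, k) = (U^n f + n U^(n-1) X k, V^n k), the squared norm of S^n x is a
   polynomial of degree at most 2 in n, that is, S is a 3-isometry.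

   As the norm of the intertwiner is irrelevant, C may be assumed to have norm
   at most 1/2.  The space K1 (+) H0, with the inner product whose cross term is
   <C P_H1 k, h>, is then complete, and a contraction G on it extending V and
   compressing to C0 on H0 can be written down with adjoints of isometries; U is
   an isometric lifting of G. *)
From HB Require Import structures.
From mathcomp Require Import all_boot all_order all_algebra.
From mathcomp Require Import complex boolp classical_sets functions reals.
From mathcomp Require Import filter topology normedtype sequences.
From mathcomp Require Import ring lra.
Require Import Defs.
Import Order.TTheory GRing.Theory Num.Theory numFieldNormedType.Exports.
Set Implicit Arguments. Unset Strict Implicit. Unset Printing Implicit Defensive.
Local Open Scope ring_scope.
Local Open Scope classical_set_scope.
Local Notation "a %:C" := (real_complex _ a) (format "a %:C") : ring_scope.
Local Notation "''i'" := (@Complex _ 0 1) : ring_scope.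
Local Notation "x +i* y" := (Complex x y)
  (at level 40, left associativity) : ring_scope.

(** * Real parts of inner products and squared norms *)

Definition rip (R : realType) (H : hilbert R) (x y : H) : R :=
  complex.Re (hinner x y).
Definition nsq (R : realType) (H : hilbert R) (x : H) : R := rip x x.

Section RealInnerProduct.
Variables (R : realType) (H : hilbert R).
Implicit Types (x y z : H) (a : R).

Lemma hinner0l y : hinner (0 : H) y = 0.
Proof.
have := hinnerDl (-1) 0 0 y; rewrite scaler0 addr0 mulN1r => E.
by rewrite E addNr.
Qed.

Lemma ripC x y : rip x y = rip y x.
Proof. by rewrite /rip (hinner_conj x y); case: (hinner x y). Qed.

Lemma rip0l y : rip (0 : H) y = 0.
Proof. by rewrite /rip hinner0l. Qed.

Lemma rip0r x : rip x (0 : H) = 0.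
Proof. by rewrite ripC rip0l. Qed.

Lemma ripDl x y z : rip (x + y) z = rip x z + rip y z.
Proof.
by have := hinnerDl 1 x y z; rewrite scale1r mul1r /rip => ->; case: hinner; case: hinner.
Qed.

Lemma hinnerZl (a : R[i]) x y : hinner (a *: x) y = a * hinner x y.
Proof. by rewrite -[a *: x]addr0 hinnerDl hinner0l addr0. Qed.

Lemma ripZl a x y : rip (a%:C *: x) y = a * rip x y.
Proof. by rewrite /rip hinnerZl; case: (hinner x y) => u v /=; ring. Qed.

Lemma ripil x y : rip ('i *: x) y = - complex.Im (hinner x y).
Proof. by rewrite /rip hinnerZl; case: (hinner x y) => u v /=; ring. Qed.

Lemma ripii x y : rip ('i *: x) ('i *: y) = rip x y.
Proof.
by rewrite ripil (hinner_conj ('i *: y)) hinnerZl /rip (hinner_conj x y);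
  case: (hinner x y) => u v /=; ring.
Qed.

Lemma ripDr x y z : rip x (y + z) = rip x y + rip x z.
Proof. by rewrite !(ripC x) ripDl. Qed.

Lemma ripZr a x y : rip x (a%:C *: y) = a * rip x y.
Proof. by rewrite !(ripC x) ripZl. Qed.

Lemma ripNl x y : rip (- x) y = - rip x y.
Proof. by apply/eqP; rewrite -subr_eq0 opprK -ripDl addNr rip0l. Qed.

Lemma ripNr x y : rip x (- y) = - rip x y.
Proof. by rewrite !(ripC x) ripNl. Qed.

Definition ripE := (ripDl, ripDr, ripNl, ripNr, ripZl, ripZr).

Lemma nsq_ge0 x : 0 <= nsq x.
Proof.
by have := hinner_ge0 x; rewrite /nsq /rip lecE => /andP[_].
Qed.

Lemma nsq_eq0 x : nsq x = 0 -> x = 0.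
Proof.
rewrite /nsq /rip => e; apply: hinner_eq0.
have := hinner_ge0 x; rewrite lecE e => /andP[/eqP].
by move: e; case: (hinner x x) => u v /= -> -> _.
Qed.

Lemma nsq0 : nsq (0 : H) = 0. Proof. exact: rip0l. Qed.

Lemma nsqN x : nsq (- x) = nsq x.
Proof. by rewrite /nsq !ripE opprK. Qed.

Lemma nsqD x y : nsq (x + y) = nsq x + 2 * rip x y + nsq y.
Proof. rewrite /nsq !ripE (ripC y x); ring. Qed.

Lemma nsqB x y : nsq (x - y) = nsq x - 2 * rip x y + nsq y.
Proof. by rewrite nsqD nsqN !ripE; ring. Qed.

Lemma nsqZ a x : nsq (a%:C *: x) = a ^+ 2 * nsq x.
Proof. by rewrite /nsq !ripE; ring. Qed.

Lemma nsqD_le x y : nsq (x + y) <= 2 * nsq x + 2 * nsq y.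
Proof. have := nsq_ge0 (x - y); rewrite nsqB nsqD; lra. Qed.

(** The real part determines the whole inner product, so identities and estimates can be proved for
    [rip], where [ring], [lra] and [nra] apply. *)
Lemma hinner_rip x y : hinner x y = rip x y +i* rip x ('i *: y).
Proof.
rewrite (ripC x ('i *: y)) ripil (hinner_conj x y) /rip.
by case: (hinner x y) => u v /=; rewrite opprK.
Qed.

Lemma rip_inj x y : (forall z, rip x z = rip y z) -> x = y.
Proof.
move=> e; apply/eqP; rewrite -subr_eq0; apply/eqP/nsq_eq0.
by rewrite /nsq ripDl ripNl e addrN.
Qed.

Lemma hnorm_sqr x : hnorm x ^+ 2 = nsq x.
Proof. by rewrite /hnorm /ipnorm sqr_sqrtr //; exact: nsq_ge0. Qed.

Lemma hnorm_lt x e : 0 < e -> (hnorm x < e) = (nsq x < e ^+ 2).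
Proof.
by move=> e0; rewrite -hnorm_sqr ltr_pXn2r ?nnegrE ?sqrtr_ge0 // ltW.
Qed.

Lemma hnorm_le x e : 0 <= e -> (hnorm x <= e) = (nsq x <= e ^+ 2).
Proof.
by move=> e0; rewrite -hnorm_sqr ler_pXn2r ?nnegrE ?sqrtr_ge0.
Qed.

End RealInnerProduct.

(** For [c > 0] the quadratic is tested at its minimum [- b / c]; for [c = 0] and [b <> 0] it would
    take the value -1. Every Cauchy-Schwarz inequality below comes from here. *)
Lemma discriminant_le (R : realFieldType) (a b c : R) : 0 <= c ->
  (forall t, 0 <= a + 2 * b * t + c * t ^+ 2) -> b ^+ 2 <= a * c.
Proof.
move=> c0 h; case: (eqVneq c 0) => [c00|cn0].
  case: (eqVneq b 0) => [->|bn0]; first by rewrite c00 expr0n /= mulr0.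
  have := h (- (a + 1) / (2 * b)); rewrite c00 mul0r addr0.
  have -> : a + 2 * b * (- (a + 1) / (2 * b)) = -1 by field.
  by rewrite lerNr oppr0 ler10.
have cp : 0 < c by rewrite lt0r cn0.
have := h (- b / c).
have -> : a + 2 * b * (- b / c) + c * (- b / c) ^+ 2 = (a * c - b ^+ 2) / c.
  by field.
by rewrite pmulr_lge0 ?invr_gt0 // subr_ge0.
Qed.

Lemma rip_CS (R : realType) (H : hilbert R) (x y : H) :
  rip x y ^+ 2 <= nsq x * nsq y.
Proof.
apply: discriminant_le; first exact: nsq_ge0.
move=> t; have := nsq_ge0 (x + t%:C *: y).
by rewrite nsqD nsqZ ripZr; congr (_ <= _); ring.
Qed.

(** * Completeness, and Hilbert spaces built from a real form *)

Definition sq_cauchy (R : realType) (V : zmodType) (q : V -> R) (u : nat -> V) :=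
  forall e : R, 0 < e -> exists N : nat, forall m n : nat,
    (N <= m)%N -> (N <= n)%N -> q (u m - u n) < e.
Definition sq_converges (R : realType) (V : zmodType) (q : V -> R)
    (u : nat -> V) (l : V) :=
  forall e : R, 0 < e -> exists N : nat, forall n : nat,
    (N <= n)%N -> q (u n - l) < e.

Lemma sq_complete (R : realType) (H : hilbert R) (u : nat -> H) :
  sq_cauchy (@nsq R H) u -> exists l, sq_converges (@nsq R H) u l.
Proof.
move=> cu; have [|l hl] := @hcomplete R H u.
  move=> e e0; have [N hN] := cu _ (exprn_gt0 2 e0).
  by exists N => m n hm hn; have := hN _ _ hm hn; rewrite -hnorm_lt.
exists l => e e0; have s0 : 0 < Num.sqrt e by rewrite sqrtr_gt0.
have [N hN] := hl _ s0; exists N => n /hN.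
by rewrite -/(hnorm _) hnorm_lt // sqr_sqrtr // ltW.
Qed.

(* [r] is the real part of the inner product; it determines the imaginary part
   because [Im <x, y> = Re <x, i y>]. *)
Section RealForm.
Variables (R : realType) (V : lmodType R[i]) (r : V -> V -> R).
Hypothesis rDl : forall x y z, r (x + y) z = r x z + r y z.
Hypothesis rZl : forall (a : R) x z, r (a%:C *: x) z = a * r x z.
Hypothesis rii : forall x z, r ('i *: x) ('i *: z) = r x z.
Hypothesis rC : forall x y, r x y = r y x.
Hypothesis r_ge0 : forall x, 0 <= r x x.
Hypothesis r_eq0 : forall x, r x x = 0 -> x = 0.
Hypothesis r_complete : forall u, sq_cauchy (fun x => r x x) u ->
  exists l, sq_converges (fun x => r x x) u l.

Definition form_ip x y : R[i] := r x y +i* r x ('i *: y).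

Let rNl x y : r (- x) y = - r x y.
Proof. by have := rZl (-1) x y; rewrite rmorphN rmorph1 scaleN1r mulN1r. Qed.

Let rixy x y : r ('i *: x) y = - r x ('i *: y).
Proof.
rewrite -(rii x ('i *: y)) scalerA -expr2 sqr_i scaleN1r.
by rewrite (rC ('i *: x) (- y)) rNl opprK rC.
Qed.

Lemma form_ipDl (a : R[i]) x y z :
  form_ip (a *: x + y) z = a * form_ip x z + form_ip y z.
Proof.
have Za w : r (a *: x) w = complex.Re a * r x w - complex.Im a * r x ('i *: w).
  rewrite {1}(complexE a) scalerDl rDl rZl (mulrC 'i) -scalerA rZl rixy; ring.
apply/eqP; rewrite eq_complex /form_ip !rDl !Za scalerA -expr2 sqr_i scaleN1r.
rewrite (rC x (- z)) rNl (rC z x).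
by case: a {Za} => a b /=; apply/andP; split; apply/eqP; ring.
Qed.

Lemma form_ip_conj x y : form_ip y x = conjc (form_ip x y).
Proof. by rewrite /form_ip /conjc (rC y x) (rC y) rixy. Qed.

Let rxi0 x : r x ('i *: x) = 0.
Proof. by have := rixy x x; rewrite (rC _ x) => e; lra. Qed.

Lemma form_ip_ge0 x : 0 <= form_ip x x.
Proof. by rewrite /form_ip rxi0 lecE /= eqxx r_ge0. Qed.

Lemma form_ip_eq0 x : form_ip x x = 0 -> x = 0.
Proof. by rewrite /form_ip => -[/r_eq0]. Qed.

Let form_norm_lt x e : 0 < e -> (ipnorm form_ip x < e) = (r x x < e ^+ 2).
Proof.
move=> e0; rewrite /ipnorm /= -[in RHS](sqr_sqrtr (r_ge0 x)).
by rewrite ltr_pXn2r ?nnegrE ?sqrtr_ge0 // ltW.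
Qed.

Lemma form_complete (u : nat -> V) : ip_cauchy form_ip u ->
  exists l, ip_converges form_ip u l.
Proof.
move=> cu; have [|l hl] := @r_complete u.
  move=> e e0; have s0 : 0 < Num.sqrt e by rewrite sqrtr_gt0.
  have [N hN] := cu _ s0; exists N => m n hm hn.
  by have := hN _ _ hm hn; rewrite form_norm_lt // sqr_sqrtr // ltW.
exists l => e e0; have [N hN] := hl _ (exprn_gt0 2 e0).
by exists N => n /hN; rewrite form_norm_lt.
Qed.

Definition form_hilbert : hilbert R :=
  Hilbert form_ipDl form_ip_conj form_ip_ge0 form_ip_eq0 form_complete.

End RealForm.

Lemma invS_lt (R : realType) (e : R) : 0 < e ->
  exists N : nat, forall n, (N <= n)%N -> n.+1%:R^-1 < e.
Proof.
move=> e0; have ei : 0 <= e^-1 by rewrite invr_ge0 ltW.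
exists (Num.Def.archi_bound e^-1) => n hn.
rewrite -[ltRHS]invrK ltf_pV2 ?posrE ?invr_gt0 ?ltr0Sn //.
by apply: lt_le_trans (archi_boundP ei) _; rewrite ler_nat leqW.
Qed.

(** * Bounded operators and adjoints *)

Section LinearMaps.
Variables (R : realType) (H K : hilbert R) (A : H -> K).
Hypothesis linA : is_linear A.

Lemma linD x y : A (x + y) = A x + A y.
Proof. by have := linA 1 x y; rewrite !scale1r. Qed.

Lemma lin0 : A 0 = 0.
Proof. by apply: (addrI (A 0)); rewrite -linD !addr0. Qed.

Lemma linZ a x : A (a *: x) = a *: A x.
Proof. by have := linA a x 0; rewrite lin0 !addr0. Qed.

Lemma linN x : A (- x) = - A x.
Proof. by rewrite -scaleN1r linZ scaleN1r. Qed.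

Lemma linB x y : A (x - y) = A x - A y.
Proof. by rewrite linD linN. Qed.

End LinearMaps.

Lemma lin_comp (R : realType) (H K L : hilbert R) (A : K -> L) (B : H -> K) :
  is_linear A -> is_linear B -> is_linear (A \o B).
Proof. by move=> hA hB a x y /=; rewrite hB hA. Qed.

Lemma nsq_sub_eq0 (R : realType) (H : hilbert R) (x y : H) : nsq (x - y) = 0 -> x = y.
Proof. by move=> /nsq_eq0 /eqP; rewrite subr_eq0 => /eqP. Qed.

Lemma norm_rip (R : realType) (H K : hilbert R) (A : H -> K) : is_linear A ->
  (forall x, nsq (A x) = nsq x) -> forall x y, rip (A x) (A y) = rip x y.
Proof.
move=> linA iA x y; have := iA (x + y); rewrite linD // !nsqD !iA; lra.
Qed.

(** Linearity of [B] lets ['i] pass through it, so the identity of real parts carries the imaginary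
    parts with it. *)
Lemma radjoint_is_adjoint (R : realType) (H K : hilbert R) (A : H -> K) (B : K -> H) :
  is_linear B -> (forall x y, rip (A x) y = rip x (B y)) ->
  is_adjoint A B.
Proof. by move=> linB adj x y; rewrite !hinner_rip !adj linZ. Qed.

Lemma isometryP (R : realType) (H K : hilbert R) (A : H -> K) : is_linear A ->
  (forall x, nsq (A x) = nsq x) -> isometric_embedding A.
Proof.
move=> linA iA; split=> // x y.
by rewrite !hinner_rip -linZ // !(norm_rip linA iA).
Qed.

(** If [2 * c] exceeded [n + M], then [4 * c ^+ 2 > (n + M) ^+ 2 >= 4 * M * n]. *)
Lemma amgm_le (R : realFieldType) (M n c : R) :
  0 <= M -> 0 <= n -> c ^+ 2 <= M * n -> - M <= n - 2 * c.
Proof.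
move=> M0 n0 h; rewrite leNgt; apply/negP => l.
have h1 : 0 < 2 * c - (n + M) by lra.
have h2 : 0 < 2 * c + (n + M) by lra.
have h3 := mulr_gt0 h1 h2; have h4 := sqr_ge0 (n - M).
nra.
Qed.

Section Riesz.
Variables (R : realType) (H : hilbert R) (f : H -> R) (M : R).
Hypothesis fD : forall x y, f (x + y) = f x + f y.
Hypothesis fZ : forall (a : R) x, f (a%:C *: x) = a * f x.
Hypothesis M0 : 0 <= M.
Hypothesis f_bounded : forall x, f x ^+ 2 <= M * nsq x.

Let phi x := nsq x - 2 * f x.

Let phi_bound x : - M <= phi x.
Proof.
exact: amgm_le M0 (nsq_ge0 x) (f_bounded x).
Qed.

(* The representing vector minimises [nsq x - 2 * f x]. *)
Lemma riesz : exists l, forall x, f x = rip l x.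
Proof.
pose E : set R := fun r => exists x, r = phi x.
have infE : has_inf E.
  split; first by exists (phi 0), 0.
  by exists (- M) => _ [x ->]; exact: phi_bound.
pose m := inf E.
have m_le x : m <= phi x.
  by apply: ge_inf; [case: infE | exists x].
have /choice[u hu] : forall n, exists x, phi x < m + n.+1%:R^-1.
  move=> n; have n0 : (0 : R) < n.+1%:R^-1 by rewrite invr_gt0 ltr0Sn.
  by have [_ [x ->] hx] := inf_adherent n0 infE; exists x.
have fN x : f (- x) = - f x.
  by have := fZ (-1) x; rewrite rmorphN rmorph1 scaleN1r mulN1r.
(* By the parallelogram law, [nsq (u p - u q)] is [2 * (phi (u p) + phi (u q))] minus four times the
   value of [phi] at the midpoint, and that value is at least [m]. *)
have [l hl] : exists l, sq_converges (@nsq R H) u l.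
  apply: sq_complete => e e0.
  have e4 : 0 < e / 4 by lra.
  have [N hN] := invS_lt e4; exists N => p q /hN hp /hN hq.
  have := m_le ((2^-1)%:C *: (u p + u q)).
  have := hu p; have := hu q; rewrite /phi nsqZ nsqB fZ fD nsqD.
  by move: p.+1%:R^-1 q.+1%:R^-1 hp hq => a b; lra.
exists l => x.
(* First variation: [phi (u n + t%:C *: x) >= m] for every [t], while
   [phi (u n) < m + n.+1%:R^-1]. *)
have key n : (rip (u n) x - f x) ^+ 2 <= n.+1%:R^-1 * nsq x.
  apply: discriminant_le; first exact: nsq_ge0.
  move=> t; have := m_le (u n + t%:C *: x); have := hu n.
  rewrite /phi nsqD nsqZ ripZr fD fZ; move: n.+1%:R^-1 => a; lra.
apply/eqP; rewrite -subr_eq0 -sqrf_eq0; apply/eqP/le_anti.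
rewrite sqr_ge0 andbT; apply/ler_addgt0Pr => e e0; rewrite add0r.
(* Two squared errors get [e / 4] each, as the square of a difference is at most twice the sum of
   the squares; the [+ 1] keeps the divisor positive at [x = 0]. *)
have c0 : 0 < e / (4 * (nsq x + 1)).
  by apply: divr_gt0 => //; have := nsq_ge0 x; lra.
have [N hN] := hl _ c0; have [N' hN'] := invS_lt c0.
have := hN _ (leq_maxl N N'); have := hN' _ (leq_maxr N N').
move: (maxn N N') => n; set d := e / _ => h1 h2.
have hd : d * (nsq x + 1) = e / 4.
  by rewrite /d; field; have := nsq_ge0 x; lra.
have := key n; have := rip_CS (u n - l) x; have := nsq_ge0 x.
have := nsq_ge0 (u n - l).
rewrite ripDl ripNl => p1 p2 p3 p4.
have q3 : (rip (u n) x - rip l x) ^+ 2 <= e / 4.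
  by apply: le_trans p3 _; rewrite -hd; apply: ler_pM => //; [exact: ltW | lra].
have q4 : (rip (u n) x - f x) ^+ 2 <= e / 4.
  apply: le_trans p4 _; rewrite -hd; apply: ler_pM => //; [|exact: ltW|lra].
  by rewrite invr_ge0.
have := sqr_ge0 (rip (u n) x - f x + (rip (u n) x - rip l x)); nra.
Qed.

End Riesz.

Section Adjoint.
Variables (R : realType) (H K : hilbert R).

Definition radjoint (A : H -> K) (B : K -> H) :=
  forall x y, rip (A x) y = rip x (B y).

Definition sq_bound (A : H -> K) (M : R) := forall x, nsq (A x) <= M * nsq x.

Lemma rip_conj (L : hilbert R) (a : R[i]) (x y : L) :
  rip (a *: x) y = rip x (conjc a *: y).
Proof.
rewrite (ripC x) /rip !hinnerZl (hinner_conj x y).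
by case: (hinner x y) => u v; case: a => c d /=; ring.
Qed.

Lemma radjoint_lin A B : is_linear A -> radjoint A B -> is_linear B.
Proof.
move=> linA adj a x y; apply: rip_inj => z.
have e w v : rip (B w) v = rip (A v) w by rewrite adj ripC.
by rewrite ripDl rip_conj !e linZ // rip_conj conjcK ripDr.
Qed.

(** Cauchy-Schwarz on [nsq (B y) = rip (A (B y)) y], then division by [nsq (B y)]. *)
Lemma radjoint_bound A B (M : R) : 0 <= M -> sq_bound A M -> radjoint A B ->
  forall y, nsq (B y) <= M * nsq y.
Proof.
move=> M0 bA adj y.
have h : nsq (B y) ^+ 2 <= M * nsq (B y) * nsq y.
  rewrite {1}/nsq -adj; apply: le_trans (rip_CS _ _) _.
  by apply: ler_wpM2r; [exact: nsq_ge0 | exact: bA].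
have [->|n0] := eqVneq (nsq (B y)) 0.
  by apply: mulr_ge0 => //; exact: nsq_ge0.
have p : 0 < nsq (B y) by rewrite lt0r n0 nsq_ge0.
by rewrite -(ler_pM2l p) -expr2; congr (_ <= _): h; ring.
Qed.

Lemma radjoint_exists A (M : R) : is_linear A -> 0 <= M -> sq_bound A M ->
  exists B, radjoint A B.
Proof.
move=> linA M0 bA.
have /choice[B hB] : forall y, exists z, forall x, rip (A x) y = rip z x.
  move=> y; apply: (@riesz _ _ _ (M * nsq y)).
  - by move=> x z; rewrite linD // ripDl.
  - by move=> a x; rewrite linZ // ripZl.
  - by apply: mulr_ge0 => //; exact: nsq_ge0.
  - move=> x; apply: le_trans (rip_CS _ _) _.
    rewrite mulrAC; apply: ler_wpM2r; [exact: nsq_ge0 | exact: bA].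
by exists B => x y; rewrite hB ripC.
Qed.

Lemma bounded_op_sq A : bounded_op A -> exists2 M, 0 <= M & sq_bound A M.
Proof.
move=> [_ [M hM]]; exists (M ^+ 2); first exact: sqr_ge0.
move=> x; rewrite -!hnorm_sqr -exprMn ler_pXn2r ?nnegrE ?sqrtr_ge0 //.
by apply: le_trans (hM x); exact: sqrtr_ge0.
Qed.

Lemma sq_bounded_op A M : is_linear A -> 0 <= M -> sq_bound A M -> bounded_op A.
Proof.
move=> linA M0 bA; split=> //; exists (Num.sqrt M) => x.
have s0 : 0 <= Num.sqrt M * hnorm x by rewrite mulr_ge0 ?sqrtr_ge0.
by rewrite hnorm_le // exprMn sqr_sqrtr // hnorm_sqr.
Qed.

Lemma contraction_sq A : contraction A -> sq_bound A 1.
Proof.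
move=> [_ cA] x; rewrite mul1r -!hnorm_sqr ler_pXn2r ?nnegrE ?sqrtr_ge0 //.
Qed.

End Adjoint.

Lemma radjoint_retract (R : realType) (H K : hilbert R) (A : H -> K) (B : K -> H) :
  is_linear A -> (forall x, nsq (A x) = nsq x) -> radjoint A B ->
  forall x, B (A x) = x.
Proof.
move=> linA iA adj x; apply: rip_inj => z.
by rewrite ripC -adj norm_rip // ripC.
Qed.

(** * Constructions of Hilbert spaces *)

Section HilbertProd.
Variables (R : realType) (G K : hilbert R).

Let r (x y : (G * K)%type) : R := rip x.1 y.1 + rip x.2 y.2.

Let r_ge0 x : 0 <= r x x.
Proof. by apply: addr_ge0; exact: nsq_ge0. Qed.

Let r_eq0 x : r x x = 0 -> x = 0.
Proof.
case: x => a b /eqP; rewrite /r /= paddr_eq0 ?nsq_ge0 //.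
by case/andP=> /eqP/nsq_eq0 -> /eqP/nsq_eq0 ->.
Qed.

Let r_complete u : sq_cauchy (fun x => r x x) u ->
  exists l, sq_converges (fun x => r x x) u l.
Proof.
move=> cu.
have [|a ha] := @sq_complete _ G (fst \o u).
  move=> e e0; have [N hN] := cu e e0; exists N => m n hm hn.
  by apply: le_lt_trans (hN m n hm hn); rewrite /r lerDl; exact: nsq_ge0.
have [|b hb] := @sq_complete _ K (snd \o u).
  move=> e e0; have [N hN] := cu e e0; exists N => m n hm hn.
  by apply: le_lt_trans (hN m n hm hn); rewrite /r lerDr; exact: nsq_ge0.
exists (a, b) => e e0.
have [N hN] := ha (e / 2) (ltac:(lra)); have [M hM] := hb (e / 2) (ltac:(lra)).
exists (maxn N M) => n; rewrite geq_max => /andP[/hN h1 /hM h2].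
by rewrite [e]splitr; exact: ltrD h1 h2.
Qed.

Definition hprod : hilbert R.
Proof.
apply: (@form_hilbert R (G * K)%type r) => //.
- by move=> x y z; rewrite /r /= !ripDl addrACA.
- by move=> a x z; rewrite /r /= !ripZl mulrDr.
- by move=> x z; rewrite /r /= !ripii.
- by move=> x y; rewrite /r ripC (ripC x.2).
Defined.

Lemma hprod_rip (x y : hprod) : rip x y = rip x.1 y.1 + rip x.2 y.2.
Proof. by []. Qed.

Lemma hprod_nsq (x : hprod) : nsq x = nsq x.1 + nsq x.2.
Proof. by []. Qed.

End HilbertProd.

Section DefectSpace.
Variables (R : realType) (H K : hilbert R) (B : H -> K).
Hypotheses (linB : is_linear B) (B_bound : sq_bound B 4^-1).

Let r (x y : H) : R := rip x y - rip (B x) (B y).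

Let r_lower x : 2^-1 * nsq x <= r x x.
Proof. by have := B_bound x; have := nsq_ge0 x; rewrite /r /nsq; lra. Qed.

Let r_upper x : r x x <= nsq x.
Proof. by rewrite /r gerBl; exact: nsq_ge0. Qed.

(** The vectors are those of [H], with the form of the identity minus the adjoint of [B] times [B].
    The bound [4^-1] makes the new norm equivalent to the old one, whence completeness. *)
Definition defect_space : hilbert R.
Proof.
apply: (@form_hilbert R H r).
- by move=> x y z; rewrite /r linD // !ripDl; ring.
- by move=> a x z; rewrite /r linZ // !ripZl; ring.
- by move=> x z; rewrite /r !linZ // !ripii.
- by move=> x y; rewrite /r ripC (ripC (B x)).
- by move=> x; have := r_lower x; have := nsq_ge0 x; lra.
- move=> x h; apply: nsq_eq0; have := r_lower x; have := nsq_ge0 x; lra.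
- move=> u cu; have [|l hl] := @sq_complete _ H u.
    move=> e e0; have [N hN] := cu (e / 2) (ltac:(lra)).
    exists N => m n hm hn; have := hN m n hm hn.
    by have := r_lower (u m - u n); lra.
  exists l => e e0; have [N hN] := hl e e0.
  by exists N => n /hN; apply: le_lt_trans; exact: r_upper.
Defined.

Lemma defect_nsq (x : defect_space) : nsq x = @nsq R H x - nsq (B x).
Proof. by []. Qed.

End DefectSpace.

(** * Square-summable sequences *)

Record l2 (R : realType) (G : hilbert R) := L2 {
  l2_fun :> nat -> G;
  l2P : exists M : R, forall n, \sum_(i < n) nsq (l2_fun i) <= M }.

Section L2.
Variables (R : realType) (G : hilbert R).
Implicit Types x y z : l2 G.

Lemma l2_ext x y : (forall i, x i = y i) -> x = y.
Proof.
case: x y => f Pf [g Pg] /= /funext e; subst g.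
by congr L2; exact: Prop_irrelevance.
Qed.

Lemma l2_zeroP : exists M : R, forall n, \sum_(i < n) nsq (0 : G) <= M.
Proof. by exists 0 => n; rewrite big1 // => i _; exact: nsq0. Qed.

Lemma l2_addP x y : exists M : R, forall n, \sum_(i < n) nsq (x i + y i) <= M.
Proof.
have [M hM] := l2P x; have [N hN] := l2P y; exists (2 * M + 2 * N) => n.
apply: (@le_trans _ _ (\sum_(i < n) (2 * nsq (x i) + 2 * nsq (y i)))).
  by apply: ler_sum => i _; exact: nsqD_le.
rewrite big_split /= -!mulr_sumr; apply: lerD; first by rewrite ler_pM2l ?hM.
by rewrite ler_pM2l ?hN.
Qed.

Lemma nsq_scale (H : hilbert R) (a : R[i]) (v : H) :
  nsq (a *: v) = (complex.Re a ^+ 2 + complex.Im a ^+ 2) * nsq v.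
Proof.
rewrite /nsq rip_conj scalerA /rip (hinner_conj _ v) hinnerZl.
have := hinner_ge0 v; rewrite lecE => /andP[/eqP]; rewrite /=.
by case: (hinner v v) => p q /= -> _; case: a => c d /=; ring.
Qed.

Lemma l2_scaleP a x : exists M : R, forall n, \sum_(i < n) nsq (a *: x i) <= M.
Proof.
have [M hM] := l2P x; exists ((complex.Re a ^+ 2 + complex.Im a ^+ 2) * M) => n.
under eq_bigr do rewrite nsq_scale.
by rewrite -mulr_sumr ler_wpM2l // addr_ge0 // sqr_ge0.
Qed.

Lemma l2_oppP x : exists M : R, forall n, \sum_(i < n) nsq (- x i) <= M.
Proof.
have [M hM] := l2P x; exists M => n.
by under eq_bigr do rewrite nsqN; exact: hM.
Qed.

HB.instance Definition _ := gen_eqMixin (l2 G).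
HB.instance Definition _ := gen_choiceMixin (l2 G).

Let zero := @L2 R G (fun=> 0) l2_zeroP.
Let add x y := @L2 R G (fun i => x i + y i) (l2_addP x y).
Let opp x := @L2 R G (fun i => - x i) (l2_oppP x).
Let scale a x := @L2 R G (fun i => a *: x i) (l2_scaleP a x).

Fact l2_addA : associative add.
Proof. by move=> x y z; apply: l2_ext => i /=; rewrite addrA. Qed.
Fact l2_addC : commutative add.
Proof. by move=> x y; apply: l2_ext => i /=; rewrite addrC. Qed.
Fact l2_add0 : left_id zero add.
Proof. by move=> x; apply: l2_ext => i /=; rewrite add0r. Qed.
Fact l2_addN : left_inverse zero opp add.
Proof. by move=> x; apply: l2_ext => i /=; rewrite addNr. Qed.

HB.instance Definition _ := GRing.isZmodule.Build (l2 G)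
  l2_addA l2_addC l2_add0 l2_addN.

Fact l2_scaleA a b x : scale a (scale b x) = scale (a * b) x.
Proof. by apply: l2_ext => i /=; rewrite scalerA. Qed.
Fact l2_scale1 : left_id 1 scale.
Proof. by move=> x; apply: l2_ext => i /=; rewrite scale1r. Qed.
Fact l2_scaleDr : right_distributive scale +%R.
Proof. by move=> a x y; apply: l2_ext => i /=; rewrite scalerDr. Qed.
Fact l2_scaleDl x : {morph (scale^~ x) : a b / a + b}.
Proof. by move=> a b; apply: l2_ext => i /=; rewrite scalerDl. Qed.

HB.instance Definition _ := GRing.Zmodule_isLmodule.Build R[i] (l2 G)
  l2_scaleA l2_scale1 l2_scaleDr l2_scaleDl.

Definition l2_rip x y : R := limn (fun n => \sum_(i < n) rip (x i) (y i)).

Let nsum x n := \sum_(i < n) nsq (x i).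

Lemma l2_nsum_nondecreasing x : nondecreasing_seq (nsum x).
Proof.
apply/nondecreasing_seqP => n; rewrite /nsum big_ord_recr /= lerDl.
exact: nsq_ge0.
Qed.

Lemma l2_nsum_cvg x : cvgn (nsum x).
Proof.
apply: nondecreasing_is_cvgn; first exact: l2_nsum_nondecreasing.
by have [M hM] := l2P x; exists M => _ [n _ <-]; exact: hM.
Qed.

(** Polarisation reduces the claim to nondecreasing bounded sequences of partial sums. *)
Lemma l2_rip_cvg x y :
  (fun n => \sum_(i < n) rip (x i) (y i)) @ \oo --> l2_rip x y.
Proof.
suff : cvgn (fun n => \sum_(i < n) rip (x i) (y i)) by [].
have -> : (fun n => \sum_(i < n) rip (x i) (y i)) =
    (fun n => 2^-1 * (nsum (x + y) n - nsum x n - nsum y n)).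
  apply/funext => n; rewrite /nsum -!sumrB mulr_sumr; apply: eq_bigr => i _.
  by rewrite nsqD; field.
apply/cvg_ex; eexists; apply: cvgM; first exact: cvg_cst.
apply: cvgB; last exact: l2_nsum_cvg.
by apply: cvgB; exact: l2_nsum_cvg.
Qed.

Lemma l2_nsum_le x n : \sum_(i < n) nsq (x i) <= l2_rip x x.
Proof.
exact: (nondecreasing_cvgn_le (@l2_nsum_nondecreasing x) (@l2_nsum_cvg x)).
Qed.

Lemma l2_rip_le x M :
  (forall n, \sum_(i < n) nsq (x i) <= M) -> l2_rip x x <= M.
Proof.
move=> h; apply: limr_le; first exact: l2_nsum_cvg.
by apply: nearW.
Qed.

Lemma l2_rip_lim x y a :
  (fun n => \sum_(i < n) rip (x i) (y i)) @ \oo --> a -> l2_rip x y = a.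
Proof. by move=> h; apply: cvg_lim. Qed.

Let rDl x y z : l2_rip (x + y) z = l2_rip x z + l2_rip y z.
Proof.
apply: l2_rip_lim; under eq_fun do under eq_bigr do rewrite ripDl.
under eq_fun do rewrite big_split /=.
by apply: cvgD; exact: l2_rip_cvg.
Qed.

Let rZl a x z : l2_rip (a%:C *: x) z = a * l2_rip x z.
Proof.
apply: l2_rip_lim; under eq_fun do under eq_bigr do rewrite ripZl.
under eq_fun do rewrite -mulr_sumr.
by apply: cvgM; [exact: cvg_cst | exact: l2_rip_cvg].
Qed.

Let rii x z : l2_rip ('i *: x) ('i *: z) = l2_rip x z.
Proof.
apply: l2_rip_lim; under eq_fun do under eq_bigr do rewrite ripii.
exact: l2_rip_cvg.
Qed.

Let rC x y : l2_rip x y = l2_rip y x.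
Proof.
apply: l2_rip_lim; under eq_fun do under eq_bigr do rewrite ripC.
exact: l2_rip_cvg.
Qed.

Let r_ge0 x : 0 <= l2_rip x x.
Proof. by have := l2_nsum_le x 0; rewrite big_ord0. Qed.

Lemma l2_coord_le x i : nsq (x i) <= l2_rip x x.
Proof.
apply: le_trans (l2_nsum_le x i.+1); rewrite big_ord_recr /= lerDr.
by apply: sumr_ge0 => k _; exact: nsq_ge0.
Qed.

Let r_eq0 x : l2_rip x x = 0 -> x = 0.
Proof.
move=> h; apply: l2_ext => i; apply: nsq_eq0; apply/le_anti.
by rewrite nsq_ge0 andbT -h l2_coord_le.
Qed.

Let r_complete u : sq_cauchy (fun x => l2_rip x x) u ->
  exists l, sq_converges (fun x => l2_rip x x) u l.
Proof.
move=> cu.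
have /choice[l hl] : forall i, exists l, sq_converges (@nsq R G) (u^~ i) l.
  move=> i; apply: sq_complete => e e0; have [N hN] := cu e e0.
  exists N => m n hm hn; apply: le_lt_trans (hN m n hm hn).
  exact: (l2_coord_le (u m - u n) i).
have finite_lim k e : 0 < e -> exists N, forall n, (N <= n)%N ->
    \sum_(i < k) nsq (u n i - l i) < e.
  elim: k e => [|k IH] e e0; first by exists 0%N => n _; rewrite big_ord0.
  have e2 : 0 < e / 2 by lra.
  have [N hN] := IH _ e2; have [M hM] := hl k _ e2.
  exists (maxn N M) => n; rewrite geq_max => /andP[/hN h1 /hM h2].
  by rewrite big_ord_recr /= [e]splitr; exact: ltrD.
(* [N] comes from the Cauchy condition alone, so it serves all [k]; only the auxiliary index [m],
   through which [u n] is compared with [l], depends on [k]. *)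
have tail e : 0 < e -> exists N, forall n, (N <= n)%N ->
    forall k, \sum_(i < k) nsq (u n i - l i) <= e.
  move=> e0; have e4 : 0 < e / 4 by lra.
  have [N hN] := cu _ e4; exists N => n hn k.
  have [M hM] := finite_lim k _ e4.
  have := hN n (maxn N M) hn (leq_maxl _ _); have := hM _ (leq_maxr N M).
  move: (maxn N M) => m h1 h2.
  have h3 := l2_nsum_le (u n - u m) k.
  apply: (@le_trans _ _ (\sum_(i < k)
      (2 * nsq (u n i - u m i) + 2 * nsq (u m i - l i)))).
    apply: ler_sum => i _; have := nsqD_le (u n i - u m i) (u m i - l i).
    by rewrite addrA subrK.
  rewrite big_split /= -!mulr_sumr.
  move: h3; rewrite /= => h3; lra.
have lP : exists M : R, forall n, \sum_(i < n) nsq (l i) <= M.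
  have [N hN] := tail _ ltr01; have [M hM] := l2P (u N).
  exists (2 * M + 2 * 1) => n.
  apply: (@le_trans _ _ (\sum_(i < n)
      (2 * nsq (u N i) + 2 * nsq (u N i - l i)))).
    apply: ler_sum => i _; have := nsqD_le (u N i) (l i - u N i).
    by rewrite addrC subrK -(nsqN (l i - _)) opprB.
  rewrite big_split /= -!mulr_sumr.
  by have := hN N (leqnn N) n; have := hM n; lra.
exists (L2 lP) => e e0; have e2 : 0 < e / 2 by lra.
have [N hN] := tail _ e2; exists N => n /hN h.
by apply: le_lt_trans (@l2_rip_le (u n - L2 lP) _ h) _; lra.
Qed.

Definition l2_hilbert : hilbert R :=
  form_hilbert rDl rZl rii rC r_ge0 r_eq0 r_complete.

Lemma l2_nsq (x : l2_hilbert) : nsq x = l2_rip x x.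
Proof. by []. Qed.

End L2.

(** * Isometric lifting of a contraction *)

Section Shift.
Variables (R : realType) (G : hilbert R).
Let K := l2_hilbert G.

Lemma l2_consP (v : G) (x : l2 G) :
  exists M : R, forall n, \sum_(i < n) nsq (if val i is j.+1 then x j else v) <= M.
Proof.
have [M hM] := l2P x; exists (nsq v + M) => -[|n].
  rewrite big_ord0; apply: addr_ge0; first exact: nsq_ge0.
  by have := hM 0%N; rewrite big_ord0.
by rewrite big_ord_recl /= lerD2l; exact: hM.
Qed.

Definition l2_cons (v : G) (x : K) : K :=
  @L2 R G (fun i => if i is j.+1 then x j else v) (l2_consP v x).

Lemma l2_cons_nsq v x : nsq (l2_cons v x) = nsq v + nsq x.
Proof.
rewrite l2_nsq; apply: l2_rip_lim; rewrite -cvg_shiftS /=.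
under eq_fun do rewrite big_ord_recl /=.
by apply: cvgD; [exact: cvg_cst | exact: l2_rip_cvg].
Qed.

Lemma l2_cons_lin a v w (x y : K) :
  l2_cons (a *: v + w) (a *: x + y) = a *: l2_cons v x + l2_cons w y.
Proof. by apply: l2_ext => -[|i]. Qed.

End Shift.

(** * Positive contractions and defect operators *)

Section PositiveContraction.
Variables (R : realType) (G : hilbert R).

Record pos_contraction (B : G -> G) : Prop := PosContraction {
  pc_lin : is_linear B;
  pc_sym : radjoint B B;
  pc_ge0 : forall x, 0 <= rip (B x) x;
  pc_le : forall x, rip (B x) x <= nsq x }.

(** Cauchy-Schwarz for the semi-inner product [rip (B x) y], taken at [x] and [B x], followed by
    [pc_le] at [B x]. *)
Lemma pc_nsq_le B x : pos_contraction B -> nsq (B x) <= rip (B x) x.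
Proof.
case=> linB symB B0 B1.
have h : nsq (B x) ^+ 2 <= rip (B x) x * rip (B (B x)) (B x).
  apply: discriminant_le => // t.
  have := B0 (x + t%:C *: B x); rewrite linD // linZ // !ripE.
  by rewrite (symB (B x) x) /nsq; congr (_ <= _); ring.
have [->|n0] := eqVneq (nsq (B x)) 0; first exact: B0.
have p : 0 < nsq (B x) by rewrite lt0r n0 nsq_ge0.
rewrite -(ler_pM2r p) -expr2; apply: le_trans h _.
by apply: ler_wpM2l.
Qed.

Lemma pc_step B : pos_contraction B -> pos_contraction (fun x => B x - B (B x)).
Proof.
move=> pB; have le := fun x => pc_nsq_le x pB; case: pB => linB symB B0 B1.
have e x : rip (B x - B (B x)) x = rip (B x) x - nsq (B x).
  by rewrite ripDl ripNl (symB (B x)).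
split.
- by move=> a x y; rewrite !linB scalerBr opprD addrACA.
- by move=> x y; rewrite ripDl ripNl ripDr ripNr !symB.
- by move=> x; rewrite e subr_ge0.
- by move=> x; rewrite e; have := B1 x; have := nsq_ge0 (B x); lra.
Qed.

Fixpoint pc_iter (B : G -> G) n : G -> G :=
  if n is m.+1 then fun x => pc_iter B m x - pc_iter B m (pc_iter B m x) else B.

Variable B : G -> G.
Hypothesis pB : pos_contraction B.

Lemma pc_iterP n : pos_contraction (pc_iter B n).
Proof. by elim: n => //= n; exact: pc_step. Qed.

Lemma pc_iter_sum n x :
  \sum_(k < n) nsq (pc_iter B k x) = rip (B x) x - rip (pc_iter B n x) x.
Proof.
elim: n => [|n IH]; first by rewrite big_ord0 addrN.
rewrite big_ord_recr /= IH ripDl ripNl.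
by rewrite (pc_sym (pc_iterP n) (pc_iter B n x)) /nsq; ring.
Qed.

Lemma pc_iter_bounded x :
  exists M : R, forall n, \sum_(k < n) nsq (pc_iter B k x) <= M.
Proof.
exists (rip (B x) x) => n; rewrite pc_iter_sum gerBl.
exact: pc_ge0 (pc_iterP n) x.
Qed.

(* A substitute for the square root of [B]: [B_0 = B] and
   [B_(n+1) = B_n - B_n ^ 2] telescope to [B = \sum_n B_n ^ 2]. *)
Definition pc_root (x : G) : l2_hilbert G :=
  @L2 R G (fun n => pc_iter B n x) (pc_iter_bounded x).

Lemma pc_root_lin : is_linear pc_root.
Proof. by move=> a x y; apply: l2_ext => n; exact: pc_lin (pc_iterP n) _ _ _. Qed.

(** If the sum [S] fell short of [b], every [rip (pc_iter B n x) x] would be at least [b - S]. By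
    Cauchy-Schwarz each [nsq (pc_iter B n x) * nsq x] would be at least [(b - S) ^+ 2], against
    summability. *)
Lemma pc_root_nsq x : nsq (pc_root x) = rip (B x) x.
Proof.
rewrite l2_nsq; set S := l2_rip _ _; set b := rip _ _.
have S_le : S <= b.
  apply: l2_rip_le => n /=; rewrite pc_iter_sum gerBl.
  exact: pc_ge0 (pc_iterP n) x.
have S_ge n : \sum_(k < n) nsq (pc_iter B k x) <= S.
  exact: (@l2_nsum_le R G (pc_root x) n).
apply/le_anti; rewrite S_le /= leNgt; apply/negP => lt.
have d0 : 0 < (b - S) ^+ 2 by rewrite exprn_gt0 // subr_gt0.
have low n : (b - S) ^+ 2 <= nsq (pc_iter B n x) * nsq x.
  apply: le_trans (rip_CS _ _).
  rewrite ler_pXn2r ?nnegrE ?subr_ge0 //; last exact: pc_ge0 (pc_iterP n) x.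
  by have := S_ge n; rewrite pc_iter_sum; lra.
have sums n : n%:R * (b - S) ^+ 2 <= S * nsq x.
  apply: (@le_trans _ _ (\sum_(k < n) nsq (pc_iter B k x) * nsq x)).
    rewrite mulr_natl -[n in _ *+ n]card_ord -sumr_const.
    by apply: ler_sum => k _; exact: low.
  by rewrite -mulr_suml; apply: ler_wpM2r => //; exact: nsq_ge0.
have q0 : 0 <= S * nsq x / (b - S) ^+ 2.
  apply: divr_ge0; last exact: ltW.
  by have := sums 0%N; rewrite mul0r.
have := archi_boundP q0; rewrite ltr_pdivrMr //.
by rewrite ltNge sums.
Qed.

End PositiveContraction.

(** [D] is a defect operator of [A]. Its values lie in [l2_hilbert G] rather than in [G], which is
    harmless: the lifting uses only its linearity and its norm. *)
Lemma defect_exists (R : realType) (G : hilbert R) (A : G -> G) :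
  is_linear A -> sq_bound A 1 -> exists D : G -> l2_hilbert G,
  is_linear D /\ forall x, nsq (D x) = nsq x - nsq (A x).
Proof.
move=> linA A1; have [A' adj] := radjoint_exists linA ler01 A1.
have linA' := radjoint_lin linA adj.
have e x : rip (x - A' (A x)) x = nsq x - nsq (A x).
  by rewrite ripDl ripNl (ripC (A' _)) -adj.
have pB : pos_contraction (fun x => x - A' (A x)).
  split.
  - by move=> a x y; rewrite linA linA' scalerBr opprD addrACA.
  - by move=> x y; rewrite !ripE (ripC (A' _) y) -!adj (ripC (A y)).
  - by move=> x; rewrite e subr_ge0 -[nsq x]mul1r.
  - by move=> x; rewrite e gerBl nsq_ge0.
exists (pc_root pB); split; first exact: pc_root_lin.
by move=> x; rewrite pc_root_nsq.
Qed.

(** Since [p] is the adjoint of the isometry [j], the projection onto the copy of [G] is [j \o p],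
    and the last clause says that [V] lifts [A]. *)
Definition isometric_lift (R : realType) (G L : hilbert R) (A : G -> G)
    (j : G -> L) (p : L -> G) (V : L -> L) : Prop :=
  [/\ is_linear j, is_linear V, radjoint j p &
  [/\ forall x, nsq (j x) = nsq x, forall x, nsq (V x) = nsq x &
      forall x, p (V x) = A (p x)]].

(** In the manner of Schaeffer, [V] applies [A] to the first component and pushes [D g] in front of
    the shifted sequence, which makes up for the norm lost under [A]. *)
Lemma isometric_lifting (R : realType) (G : hilbert R) (A : G -> G) :
  is_linear A -> sq_bound A 1 ->
  exists (L : hilbert R) (j : G -> L) (p : L -> G) (V : L -> L),
  isometric_lift A j p V.
Proof.
move=> linA A1; have [D [linD_ normD]] := defect_exists linA A1.
pose L := hprod G (l2_hilbert (l2_hilbert G)).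
exists L, (fun g => (g, 0) : L), (fun x : L => x.1).
exists (fun x : L => (A x.1, l2_cons (D x.1) x.2) : L); split.
- by move=> a x y; congr pair; rewrite /= scaler0 addr0.
- move=> a x y; congr pair => /=; first by rewrite linA.
  by rewrite linD_ l2_cons_lin.
- by move=> x y; rewrite hprod_rip /= rip0l addr0.
split=> // x; first by rewrite hprod_nsq /= nsq0 addr0.
by rewrite !hprod_nsq /= l2_cons_nsq normD; ring.
Qed.

(** * Lifting of intertwiners *)

Lemma sq_bound_comp (R : realType) (H K L : hilbert R) (A : K -> L) (B : H -> K) M N :
  0 <= M -> sq_bound A M -> sq_bound B N -> sq_bound (A \o B) (M * N).
Proof.
move=> M0 bA bB x /=; apply: le_trans (bA _) _.
by rewrite -mulrA ler_wpM2l.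
Qed.

Section ContractiveExtension.
Variables (R : realType) (H0 H1 K1 : hilbert R).
Variables (C0 : H0 -> H0) (C1 : H1 -> H1) (C : H1 -> H0).
Variables (j : H1 -> K1) (p : K1 -> H1) (V : K1 -> K1).
Hypotheses (linC0 : is_linear C0) (linC1 : is_linear C1) (linC : is_linear C).
Hypotheses (C0_le1 : sq_bound C0 1) (C1_le1 : sq_bound C1 1).
Hypothesis C_small : sq_bound C 4^-1.
Hypothesis CC1 : forall b, C (C1 b) = C0 (C b).
Hypotheses (linj : is_linear j) (linV : is_linear V) (adj_j : radjoint j p).
Hypotheses (iso_j : forall x, nsq (j x) = nsq x) (iso_V : forall x, nsq (V x) = nsq x).
Hypothesis pV : forall x, p (V x) = C1 (p x).

Variables (C0' : H0 -> H0) (C1' : H1 -> H1) (C' : H0 -> H1) (V' : K1 -> K1).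
Hypotheses (adj0 : radjoint C0 C0') (adj1 : radjoint C1 C1').
Hypotheses (adjC : radjoint C C') (adjV : radjoint V V').

Let linC0' := radjoint_lin linC0 adj0.
Let linC1' := radjoint_lin linC1 adj1.
Let linC' := radjoint_lin linC adjC.
Let linV' := radjoint_lin linV adjV.

Let C'_small : sq_bound C' 4^-1.
Proof. by apply: radjoint_bound adjC; rewrite ?invr_ge0. Qed.

Let C1'C'_small : sq_bound (C1' \o C') 4^-1.
Proof.
rewrite -[4^-1]mul1r; apply: sq_bound_comp => //.
exact: radjoint_bound adj1.
Qed.

Let C1'C' h : C1' (C' h) = C' (C0' h).
Proof. by apply: rip_inj => b; rewrite !(ripC _ b) -adj1 -!adjC CC1 adj0. Qed.

(** Dual form of [pV]: the adjoint of [V] restricts to [C1'] on the copy of [H1]. *)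
Let V'j x : V' (j x) = j (C1' x).
Proof.
apply: rip_inj => z.
by rewrite !(ripC _ z) -adjV !(ripC _ (j _)) !adj_j pV ripC adj1 ripC.
Qed.

(** When [K1] and [H0] are joined with cross term [rip (C (p k)) h], the projection of [h] to [K1]
    is [j (C' h)], and the remainder has squared norm [nsq h - nsq (C' h)], the norm used here. This
    turns the joined space into an orthogonal sum. *)
Definition defect_C := defect_space linC' C'_small.
Definition defect_C1C := defect_space (lin_comp linC1' linC') C1'C'_small.
Definition coupling := hprod K1 defect_C.

(* [coupling] contains [K1] and, through [coupling_in], [H0], so that the
   compression of the inclusion of [K1] to [H0] is [C \o p]. *)
Definition coupling_in (h : H0) : coupling := (j (C' h), h).

(* A contraction [M] with first coordinate [V' k] that satisfies
   [M (coupling_in h) = coupling_in (C0' h)] has its second coordinate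
   prescribed on the range of [Q]; as [Q] is isometric and [C0'] is contractive
   from [defect_C1C] to [defect_C], [C0' \o Q'] is an admissible choice. *)
Let Q (h : defect_C1C) : coupling := (j (C' h) - V (V' (j (C' h))), h).

Let linQ : is_linear Q.
Proof.
move=> a x y; congr pair.
by rewrite /= linC' linj linV' linV opprD scalerBr addrACA.
Qed.

Let V'_split k : nsq (k - V (V' k)) = nsq k - nsq (V' k).
Proof. by rewrite nsqB iso_V (ripC k) adjV /nsq; ring. Qed.

(** The first coordinate contributes [nsq (C' h) - nsq (C1' (C' h))], which turns the defect norm of
    [C'] into that of [C1' \o C']. *)
Let isoQ h : nsq (Q h) = nsq h.
Proof.
rewrite hprod_nsq /= V'_split V'j !iso_j !defect_nsq /=; ring.
Qed.

(** The adjoint of [M] is the contraction sought: the third clause makes it lift [C0], the fourth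
    makes it extend [V]. *)
Lemma contractive_extension : exists M : coupling -> coupling,
  [/\ is_linear M, sq_bound M 1,
      forall h, M (coupling_in h) = coupling_in (C0' h) &
      forall z, (M z).1 = V' z.1].
Proof.
have Q1 : sq_bound Q 1 by move=> h; rewrite isoQ mul1r.
have [Q' adjQ] := radjoint_exists linQ ler01 Q1.
have linQ' := radjoint_lin linQ adjQ.
have Q'1 := radjoint_bound ler01 Q1 adjQ.
have Q'Q := radjoint_retract linQ isoQ adjQ.
pose M (z : coupling) : coupling := (V' z.1, C0' (Q' (z.1 - V (V' z.1), z.2))).
(* By [C1'C'] the subtracted terms of the two defect norms agree; what remains is that [C0'] is a
   contraction on [H0]. *)
have C0'_le (h : defect_C1C) : @nsq R defect_C (C0' h) <= nsq h.
  rewrite !defect_nsq /= C1'C' lerB //.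
  by have := radjoint_bound ler01 C0_le1 adj0 h; rewrite mul1r.
exists M; split=> //.
- move=> a x y; congr pair; first exact: linV'.
  rewrite -linC0' -linQ'; congr (C0' (Q' (pair _ _))).
  by rewrite /= linV' linV opprD scalerBr addrACA.
- move=> z; rewrite mul1r hprod_nsq /=.
  apply: le_trans (lerD (lexx _) (C0'_le _)) _.
  apply: le_trans (lerD (lexx _) (Q'1 _)) _.
  by rewrite mul1r hprod_nsq /= V'_split [nsq z]hprod_nsq; lra.
- by move=> h; rewrite /M /= -/(Q h) Q'Q V'j C1'C'.
Qed.

End ContractiveExtension.

(* Commutant lifting for intertwiners, under the normalisation
   [|C x|^2 <= |x|^2 / 4]. *)
Lemma intertwining_lifting (R : realType) (H0 H1 : hilbert R)
    (C0 : H0 -> H0) (C1 : H1 -> H1) (C : H1 -> H0) :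
  is_linear C0 -> is_linear C1 -> is_linear C ->
  sq_bound C0 1 -> sq_bound C1 1 -> sq_bound C 4^-1 ->
  (forall b, C (C1 b) = C0 (C b)) ->
  exists (F : hilbert R) (i : H0 -> F) (q : F -> H0) (U : F -> F)
    (K : hilbert R) (j : H1 -> K) (p : K -> H1) (V : K -> K) (X : K -> F),
  [/\ isometric_lift C0 i q U, isometric_lift C1 j p V, is_linear X &
  [/\ forall k, nsq (X k) = nsq k, forall k, U (X k) = X (V k) &
      forall k, q (X k) = C (p k)]].
Proof.
move=> linC0 linC1 linC C0_le1 C1_le1 C_small CC1.
have [K [j [p [V liftV]]]] := isometric_lifting linC1 C1_le1.
have [linj linV adj_j [iso_j iso_V pV]] := liftV.
have [C0' adj0] := radjoint_exists linC0 ler01 C0_le1.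
have [C1' adj1] := radjoint_exists linC1 ler01 C1_le1.
have q0 : 0 <= (4^-1 : R) by rewrite invr_ge0.
have [C' adjC] := radjoint_exists linC q0 C_small.
have V_le1 : sq_bound V 1 by move=> x; rewrite iso_V mul1r.
have [V' adjV] := radjoint_exists linV ler01 V_le1.
have [M [linM M_le1 MY MX]] := contractive_extension linC0 linC1 linC C0_le1
  C1_le1 C_small CC1 linj linV adj_j iso_j iso_V pV adj0 adj1 adjC adjV.
move: M linM M_le1 MY MX.
set E := coupling _ _ _ _; set Y := coupling_in j linC C_small adjC => M linM M_le1 MY MX.
have linC' := radjoint_lin linC adjC.
have linY : is_linear Y.
  by move=> a x y; congr pair; rewrite /= linC' linj.
have iso_Y h : nsq (Y h) = nsq h.
  by rewrite hprod_nsq /= iso_j defect_nsq addrC subrK.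
have Y_le1 : sq_bound Y 1 by move=> h; rewrite iso_Y mul1r.
have [Y' adjY] := radjoint_exists linY ler01 Y_le1.
have [G adjG] := radjoint_exists linM ler01 M_le1.
have linG := radjoint_lin linM adjG.
have Y'G z : Y' (G z) = C0 (Y' z).
  apply: rip_inj => h.
  by rewrite !(ripC _ h) -adjY -adjG MY adjY ripC -adj0 ripC.
pose X0 (k : K) : E := (k, 0).
have GX0 k : G (X0 k) = X0 (V k).
  apply: rip_inj => z; rewrite !(ripC _ z) -adjG !hprod_rip /= !rip0r.
  by rewrite MX ripC -adjV ripC.
have [F [i [q [U [lini linU adj_i [iso_i iso_U qU]]]]]] :=
  isometric_lifting linG (radjoint_bound ler01 M_le1 adjG).
have qi := radjoint_retract lini iso_i adj_i.
exists F, (i \o Y), (Y' \o q), U, K, j, p, V, (i \o X0); split=> //.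
- split=> //; first exact: lin_comp.
    by move=> x y /=; rewrite adj_i adjY.
  by split=> // x /=; [rewrite iso_i iso_Y | rewrite qU Y'G].
- apply: lin_comp => // a x y; congr pair; by rewrite /= scaler0 addr0.
have iso_X0 k : nsq (X0 k) = nsq k by rewrite hprod_nsq /= nsq0 addr0.
split=> k /=; first by rewrite iso_i.
  (* An isometric lifting extends [G] wherever [G] preserves norms: [U (i (X0 k))] and
     [i (X0 (V k))] have equal norms, and their inner product is the square of that norm because
     [q \o U \o i] is [G]. *)
  apply: nsq_sub_eq0; rewrite nsqB iso_U !iso_i (ripC (U _)) adj_i qU qi GX0.
  by rewrite -/(nsq _) !iso_X0 iso_V; ring.
(* The compression of [X0] to [H0] is [C \o p], since [Y h] has first coordinate [j (C' h)]. *)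
rewrite qi; apply: rip_inj => h; rewrite !(ripC _ h) -adjY hprod_rip /= rip0r.
by rewrite addr0 adj_j ripC -adjC ripC.
Qed.

(** * The 3-isometric lifting *)

Section Triangular.
Variables (R : realType) (F K : hilbert R).
Variables (U : F -> F) (V : K -> K) (Z : K -> F).
Hypotheses (linU : is_linear U) (linV : is_linear V) (linZ : is_linear Z).
Hypotheses (iso_U : forall f, nsq (U f) = nsq f) (iso_V : forall k, nsq (V k) = nsq k).
Hypothesis UZ : forall k, U (Z k) = Z (V k).

Definition triangular (x : hprod F K) : hprod F K := (U x.1 + Z x.2, V x.2).

Lemma triangular_lin : is_linear triangular.
Proof.
move=> a x y; congr pair; rewrite /= ?linV //.
by rewrite linU linZ scalerDr addrACA.
Qed.

Lemma rip_iter (H : hilbert R) (S S' : H -> H) n x y : radjoint S S' ->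
  rip (iter n S' x) y = rip x (iter n S y).
Proof.
move=> adj; elim: n x y => //= n IH x y.
by rewrite ripC -adj ripC IH -iterSr.
Qed.

(* [|S^n x|^2] is a polynomial of degree at most 2 in [n], so its third
   difference vanishes. *)
Lemma triangular_three_isometric M : 0 <= M -> sq_bound Z M ->
  three_isometric triangular.
Proof.
move=> M0 bZ.
have M3 : 0 <= 3 + 2 * M by lra.
have bS : sq_bound triangular (3 + 2 * M).
  move=> x; rewrite !hprod_nsq /= iso_V.
  have := nsqD_le (U x.1) (Z x.2); rewrite iso_U.
  have := bZ x.2; have := nsq_ge0 x.1; have := nsq_ge0 x.2.
  by have := mulr_ge0 M0 (nsq_ge0 x.1); nra.
split; first exact: sq_bounded_op triangular_lin M3 bS.
have [S' adj] := radjoint_exists triangular_lin M3 bS.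
exists S'; split.
  exact: radjoint_is_adjoint (radjoint_lin triangular_lin adj) adj.
move=> x; apply: rip_inj => y; rewrite rip0l.
pose r n := rip (iter n triangular x) (iter n triangular y).
(* Tested against [y], the sum becomes [r 0 - 3 * r 1 + 3 * r 2 - r 3]. *)
rewrite (big_morph (fun v : hprod F K => rip v y) (fun v w => ripDl v w y) (rip0l y)).
have coef (k : 'I_4) : rip ((((-1) ^+ k * ('C(3, k))%:R) : R[i]) *:
    iter k S' (iter k triangular x)) y = (-1) ^+ k * 'C(3, k)%:R * r k.
  have -> : ((-1) ^+ k * ('C(3, k))%:R : R[i]) = ((-1) ^+ k * ('C(3, k))%:R)%:C.
    by rewrite rmorphM rmorphXn rmorphN1 rmorph_nat.
  by rewrite ripZl (rip_iter _ _ _ adj).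
under eq_bigr do rewrite coef.
rewrite !big_ord_recl big_ord0 /= /bump /=.
have -> : ('C(3, 1 + 1) = 3)%N by [].
have -> : ('C(3, 1 + (1 + 1)) = 1)%N by [].
rewrite bin0 bin1.
have U2 f g : rip (U f) (U g) = rip f g by exact: norm_rip.
have V2 f g : rip (V f) (V g) = rip f g by exact: norm_rip.
(* [UZ] collects the [Z] terms under the outer copies of [U], which drop out of the inner products;
   [n] copies of [Z] remain in [r n]. *)
have S2 z : iter 2 triangular z = (U (U z.1 + Z z.2 + Z z.2), V (V z.2)).
  by congr pair; rewrite /= -UZ -linD.
have S3 z : iter 3 triangular z =
    (U (U (U z.1 + Z z.2 + Z z.2 + Z z.2)), V (V (V z.2))).
  by rewrite iterS S2; congr pair; rewrite /= -!UZ -!linD.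
rewrite /r !S2 !S3 !hprod_rip /=.
rewrite !V2 !U2 !ripE U2.
ring.
Qed.

End Triangular.

Theorem theorem4p1 (R : realType) (H H0 H1 : hilbert R)
    (E0 : H0 -> H) (E1 : H1 -> H)
    (T : H -> H) (C0 : H0 -> H0) (C1 : H1 -> H1) (C : H1 -> H0) :
  (* H = H0 (+) H1 orthogonal decomposition *)
  isometric_embedding E0 -> isometric_embedding E1 ->
  (forall (a : H0) (b : H1), hinner (E0 a) (E1 b) = 0) ->
  (forall h : H, exists (a : H0) (b : H1), h = E0 a + E1 b) ->
  (* T in B(H) has block form [[C0, C], [0, C1]] *)
  bounded_op T ->
  (forall a : H0, T (E0 a) = E0 (C0 a)) ->
  (forall b : H1, T (E1 b) = E0 (C b) + E1 (C1 b)) ->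
  contraction C0 -> contraction C1 -> bounded_op C ->
  (forall b : H1, C (C1 b) = C0 (C b)) ->
  exists (K : hilbert R) (J : H -> K) (Jstar : K -> H) (S : K -> K),
    isometric_embedding J /\ is_adjoint J Jstar /\
    three_isometric S /\ is_lifting J Jstar T S.
Proof.
move=> [linE0 isoE0] [linE1 isoE1] orth decomp [linT _] TE0 TE1 cC0 cC1 bC CC1.
have [M M0 bM] := bounded_op_sq bC.
have [[linC0 _] _] := cC0; have [[linC1 _] _] := cC1; have [linC _] := bC.
have nE0 a : nsq (E0 a) = nsq a by rewrite /nsq /rip isoE0.
have nE1 b : nsq (E1 b) = nsq b by rewrite /nsq /rip isoE1.
have orth0 a b : rip (E0 a) (E1 b) = 0 by rewrite /rip orth.
(* Both [c] and [c * M] are at most 1/2, hence [c ^+ 2 * M <= 4^-1]; the [+ 1] covers [M = 0]. *)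
pose c : R := (2 * (M + 1))^-1.
have c0 : 0 < c by rewrite invr_gt0; lra.
have lin_cC : is_linear (fun b => c%:C *: C b).
  by move=> a x y; rewrite linC scalerDr !scalerA mulrC.
have cC_small : sq_bound (fun b => c%:C *: C b) 4^-1.
  move=> b; rewrite nsqZ.
  have e : c * (2 * (M + 1)) = 1 by rewrite mulVf // gt_eqF //; lra.
  have hM : c ^+ 2 * M <= 4^-1.
    have := sqr_ge0 c; nra.
  apply: le_trans (ler_wpM2l (sqr_ge0 c) (bM b)) _.
  by rewrite mulrA; apply: ler_wpM2r hM; exact: nsq_ge0.
have cCC1 b : c%:C *: C (C1 b) = C0 (c%:C *: C b) by rewrite CC1 linZ.
have [F [i [q [U [K [j [p [V [X [liftU liftV linX [isoX UX qX]]]]]]]]]]] :=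
  intertwining_lifting linC0 linC1 lin_cC (contraction_sq cC0) (contraction_sq cC1)
    cC_small cCC1.
have [lini linU adj_i [iso_i iso_U qU]] := liftU.
have [linj linV adj_j [iso_j iso_V pV]] := liftV.
have linq := radjoint_lin lini adj_i; have linp := radjoint_lin linj adj_j.
have [|E0' adj0] := radjoint_exists linE0 ler01; first by move=> a; rewrite nE0 mul1r.
have [|E1' adj1] := radjoint_exists linE1 ler01; first by move=> a; rewrite nE1 mul1r.
have linE0' := radjoint_lin linE0 adj0; have linE1' := radjoint_lin linE1 adj1.
(* The adjoints of [E0] and [E1] are the coordinate maps of the decomposition. *)
have E0'E a b : E0' (E0 a + E1 b) = a.
  apply: rip_inj => z; rewrite ripC -adj0 ripDr orth0 addr0.
  by rewrite adj0 (radjoint_retract linE0 nE0 adj0) ripC.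
have E1'E a b : E1' (E0 a + E1 b) = b.
  apply: rip_inj => z; rewrite ripC -adj1 ripDr (ripC _ (E0 a)) orth0 add0r.
  by rewrite adj1 (radjoint_retract linE1 nE1 adj1) ripC.
(* Dividing by [c] undoes the normalisation: [X] lifts [c] times [C], so [q (Z k) = C (p k)]. The
   3-isometry asks only for a bounded intertwiner, not an isometric one. *)
pose Z k := (c^-1)%:C *: X k.
have linZ_ : is_linear Z.
  by move=> a x y; rewrite /Z linX scalerDr !scalerA mulrC.
have UZ k : U (Z k) = Z (V k) by rewrite /Z linZ // UX.
have bZ : sq_bound Z (c^-1 ^+ 2) by move=> k; rewrite nsqZ isoX.
exists (hprod F K), (fun h => (i (E0' h), j (E1' h))).
exists (fun x => E0 (q x.1) + E1 (p x.2)), (triangular U V Z).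
split.
  apply: isometryP.
    by move=> a x y; congr pair; rewrite /= ?linE0' ?linE1' ?lini ?linj.
  move=> h; have [a [b ->]] := decomp h.
  rewrite hprod_nsq /= E0'E E1'E iso_i iso_j nsqD orth0 nE0 nE1; ring.
split.
  apply: radjoint_is_adjoint.
    move=> a x y /=; rewrite linq linp linE0 linE1 scalerDr addrACA //.
  by move=> h x; rewrite hprod_rip /= adj_i adj_j (ripC (E0' h)) -adj0 (ripC (E1' h)) -adj1
    -ripDl ripC.
split.
  exact: triangular_three_isometric linU linV linZ_ iso_U iso_V UZ _ (sqr_ge0 _) bZ.
move=> x.
(* The lifting identity holds even before the outer embedding, componentwise along [E0] and [E1]. *)
suff -> : T (E0 (q x.1) + E1 (p x.2)) =
    E0 (q (triangular U V Z x).1) + E1 (p (triangular U V Z x).2) by [].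
rewrite (linD linT) TE0 TE1 /= (linD linq) qU pV /Z (linZ linq) qX scalerA -rmorphM.
by rewrite mulVf ?gt_eqF // scale1r (linD linE0) addrA.
Qed.
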